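(* Let $\mathfrak{h}$ be a non-abelian solvable real Lie algebra of dimension three. If the cotangent Lie algebra $T^*\mathfrak{h}$ admits a complex structure, then $\mathfrak{h}$ is isomorphic to one of the following Lie algebras: $\mathfrak{h}_1$, $\mathbb{R}\times\mathfrak{aff}(\mathbb{R})$, $\mathfrak{r}_{3,1}$, $\mathfrak{r}_{3,-1}$, or $\mathfrak{r}_{3,\eta}'$ for some $\eta\geq 0$.
   Context: The three-dimensional real Lie algebras have basis $e_1,e_2,e_3$ and non-zero brackets: $\mathfrak{h}_1$: $[e_1,e_2]=e_3$; $\mathbb{R}\times\mathfrak{aff}(\mathbb{R})$: $[e_1,e_2]=e_2$; $\mathfrak{r}_{3,1}$: $[e_1,e_2]=e_2$, $[e_1,e_3]=e_3$; $\mathfrak{r}_{3,-1}$: $[e_1,e_2]=e_2$, $[e_1,e_3]=-e_3$; $\mathfrak{r}_{3,\eta}'$ ($\eta\ge 0$): $[e_1,e_2]=\eta e_2-e_3$, $[e_1,e_3]=e_2+\eta e_3$. The cotangent Lie algebra $T^*\mathfrak{h}$ is $\mathfrak{h}\oplus\mathfrak{h}^*$ with bracket $[(x,\varphi),(x',\varphi')]=([x,x'],\mathrm{ad}^*(x)\varphi'-\mathrm{ad}^*(x')\varphi)$, where $(\mathrm{ad}^*(x)\varphi)(y)=-\varphi([x,y])$. A complex structure on a real Lie algebra $\mathfrak{g}$ is a linear map $J:\mathfrak{g}\to\mathfrak{g}$ with $J^2=-\mathrm{I}$ and $[Jx,Jy]-[x,y]-J[Jx,y]-J[x,Jy]=0$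 for all $x,y\in\mathfrak{g}$. *)

(* Defs.v *)
From HB Require Import structures.
From mathcomp Require Import all_boot all_order all_algebra.
From mathcomp Require Import ring.
From mathcomp Require Export reals.

Set Implicit Arguments.
Unset Strict Implicit.
Unset Printing Implicit Defensive.

Import GRing.Theory.
Local Open Scope ring_scope.

HB.mixin Record Vector_isLie (R : fieldType) (g : Type) of Vector R g := {
  lie : g -> g -> g;
  lie_linearl : forall y : g, linear (fun x => lie x y);
  lie_linearr : forall x : g, linear (lie x);
  liexx : forall x : g, lie x x = 0;
  lie_jacobi : forall x y z : g,
    lie x (lie y z) + lie y (lie z x) + lie z (lie x y) = 0
}.

#[short(type="lieAlgType")]
HB.structure Definition LieAlgebra (R : fieldType) :=
  {g of Vector_isLie R g & Vector R g}.

HB.instance Definition _ (R : fieldType) (g : lieAlgType R) (x : g) :=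
  GRing.isLinear.Build R g g *:%R (lie x) (lie_linearr x).

Section LieTheory.
Context {R : fieldType} {g : lieAlgType R}.
Implicit Types (x y z : g) (U V W : {vspace g}).

Lemma lieDl x y z : lie (x + y) z = lie x z + lie y z.
Proof. by have := lie_linearl z 1 x y; rewrite !scale1r. Qed.

Lemma lie0l z : lie 0 z = 0.
Proof. by apply: (addrI (lie 0 z)); rewrite -lieDl !addr0. Qed.

Lemma lieZl a x z : lie (a *: x) z = a *: lie x z.
Proof. by have := lie_linearl z a x 0; rewrite !addr0 lie0l addr0. Qed.

Lemma lie_suml I (r : seq I) (P : pred I) (F : I -> g) z :
  lie (\sum_(i <- r | P i) F i) z = \sum_(i <- r | P i) lie (F i) z.
Proof.
exact: (big_morph (fun x => lie x z) (fun x y => lieDl x y z) (lie0l z)).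
Qed.

Lemma lie_anti x y : lie x y = - lie y x.
Proof.
apply/eqP; rewrite -addr_eq0; apply/eqP.
by have := liexx (x + y); rewrite lieDl !linearD /= !liexx addr0 add0r.
Qed.

Definition lie_abelian (h : lieAlgType R) : Prop := forall x y : h, lie x y = 0.

Definition lie_prodv U V : {vspace g} :=
  <<allpairs (@lie R g) (vbasis U) (vbasis V)>>%VS.

Lemma memv_lie U V x y : x \in U -> y \in V -> lie x y \in lie_prodv U V.
Proof.
move=> /coord_vbasis -> /coord_vbasis ->.
rewrite linear_sum memv_suml // => j _; rewrite linearZ memvZ //=.
rewrite lie_suml memv_suml // => i _; rewrite lieZl memvZ // memv_span //.
by apply: allpairs_f; rewrite mem_nth ?size_tuple.
Qed.

Lemma lie_prodvP U V W :
  reflect (forall x y, x \in U -> y \in V -> lie x y \in W)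
          (lie_prodv U V <= W)%VS.
Proof.
apply: (iffP idP) => [sUVW x y xU yV|UVW].
  exact: (subvP sUVW) (memv_lie xU yV).
apply/span_subvP => _ /allpairsP[[x y] /= [xU yV ->]].
by apply: UVW; apply: vbasis_mem.
Qed.

Fixpoint derived_lie (n : nat) : {vspace g} :=
  if n is m.+1 then lie_prodv (derived_lie m) (derived_lie m) else fullv.

End LieTheory.

Definition lie_solvable (R : fieldType) (g : lieAlgType R) : Prop :=
  exists n, derived_lie n = 0%VS :> {vspace g}.

Definition lie_isomorphic (R : fieldType) (g h : lieAlgType R) : Prop :=
  exists f : {linear g -> h},
    bijective f /\ forall x y : g, f (lie x y) = lie (f x) (f y).

Definition complex_structure (R : fieldType) (g : lieAlgType R) (J : 'End(g)) :
    Prop :=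
  (forall x : g, J (J x) = - x) /\
  (forall x y : g,
     lie (J x) (J y) - lie x y - J (lie (J x) y) - J (lie x (J y)) = 0).

Definition coad (R : fieldType) (g : lieAlgType R) (x : g)
    (phi : 'Hom(g, R^o)) : 'Hom(g, R^o) := - (phi \o linfun (lie x))%VF.

Lemma coadE (R : fieldType) (g : lieAlgType R) (x : g)
  (phi : 'Hom(g, R^o)) (y : g) : coad x phi y = - phi (lie x y).
Proof. by rewrite /coad opp_lfunE comp_lfunE lfunE. Qed.

Definition cotangent (R : fieldType) (h : lieAlgType R) : Type :=
  (h * 'Hom(h, R^o))%type.

Section Cotangent.
Variables (R : fieldType) (h : lieAlgType R).

HB.instance Definition _ := Vector.on (cotangent h).

Definition cotangent_lie (u v : cotangent h) : cotangent h :=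
  (lie u.1 v.1, coad u.1 v.2 - coad v.1 u.2).

Lemma cotangent_liexx u : cotangent_lie u u = 0.
Proof. by rewrite /cotangent_lie liexx subrr. Qed.

Lemma cotangent_linearr u : linear (cotangent_lie u).
Proof.
move=> a v w; congr (_, _); first by rewrite linearP.
apply/lfunP => y; rewrite /= !(coadE, add_lfunE, opp_lfunE, scale_lfunE).
rewrite ?comp_lfunE ?lfunE /=.
rewrite lieDl lieZl [u.2 _]linearP.
have ringE (k p q r s : R) :
  - (k * p + q) - - (k * r + s) = k * (- p - - r) + (- q - - s) by ring.
exact: ringE.
Qed.

Lemma cotangent_anti u v : cotangent_lie u v = - cotangent_lie v u.
Proof. by congr (_, _); [exact: lie_anti | rewrite /= opprB]. Qed.

Lemma cotangent_linearl v : linear (fun u => cotangent_lie u v).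
Proof.
move=> a u w; rewrite cotangent_anti cotangent_linearr.
by rewrite opprD -scalerN -!cotangent_anti.
Qed.

Lemma cotangent_jacobi u v w :
  cotangent_lie u (cotangent_lie v w) + cotangent_lie v (cotangent_lie w u)
    + cotangent_lie w (cotangent_lie u v) = 0.
Proof.
congr (_, _); first exact: lie_jacobi.
apply/lfunP => y.
rewrite /= zero_lfunE !(coadE, add_lfunE, opp_lfunE).
rewrite ?comp_lfunE ?lfunE /=.
have adM (a b : h) : lie (lie a b) y = lie a (lie b y) - lie b (lie a y).
  have /eqP := lie_jacobi a b y; rewrite addrC addr_eq0 => /eqP.
  rewrite lie_anti => /eqP; rewrite eqr_opp => /eqP ->.
  by rewrite [lie y a]lie_anti linearN.
by rewrite !adM !linearB /=; ring.
Qed.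

HB.instance Definition _ := Vector_isLie.Build R (cotangent h)
  cotangent_linearl cotangent_linearr cotangent_liexx cotangent_jacobi.

End Cotangent.

(* The algebra with basis e_1, e_2, e_3 and brackets
     [e_1, e_2] = a e_2 + b e_3, [e_1, e_3] = c e_2 + d e_3, [e_2, e_3] = 0.
   The five families below are all of this form; see the lemmas *_brackets. *)
Definition lie3 (R : fieldType) (a b c d : R) : Type := 'rV[R]_3.

Definition e_ (R : fieldType) (i : 'I_3) : 'rV[R]_3 := delta_mx 0 i.
Local Notation e1 := (e_ _ 0).
Local Notation e2 := (e_ _ 1).
Local Notation e3 := (e_ _ 2).

Section Lie3.
Variables (R : fieldType) (a b c d : R).

HB.instance Definition _ := Vector.on (lie3 a b c d).

Definition lie3_lie (x y : lie3 a b c d) : lie3 a b c d :=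
  (x 0 0 * y 0 1 - x 0 1 * y 0 0) *: (a *: e2 + b *: e3)
    + (x 0 0 * y 0 2 - x 0 2 * y 0 0) *: (c *: e2 + d *: e3).

Lemma lie3_liexx x : lie3_lie x x = 0.
Proof. by apply/rowP => j; rewrite !mxE; ring. Qed.

Lemma lie3_linearr x : linear (lie3_lie x).
Proof. by move=> k y z; apply/rowP => j; rewrite !mxE; ring. Qed.

Lemma lie3_linearl y : linear (fun x => lie3_lie x y).
Proof. by move=> k x z; apply/rowP => j; rewrite !mxE; ring. Qed.

Lemma lie3_jacobi x y z :
  lie3_lie x (lie3_lie y z) + lie3_lie y (lie3_lie z x)
    + lie3_lie z (lie3_lie x y) = 0.
Proof. by apply/rowP => j; rewrite !mxE /=; ring. Qed.

HB.instance Definition _ := Vector_isLie.Build R (lie3 a b c d)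
  lie3_linearl lie3_linearr lie3_liexx lie3_jacobi.

Lemma lie3_brackets :
  [/\ lie (e1 : lie3 a b c d) e2 = a *: e2 + b *: e3,
      lie (e1 : lie3 a b c d) e3 = c *: e2 + d *: e3 &
      lie (e2 : lie3 a b c d) e3 = 0].
Proof. by split; apply/rowP => j; rewrite !mxE /=; ring. Qed.

End Lie3.

Definition heis3 (R : fieldType) : lieAlgType R := lie3 (0 : R) 1 0 0.
Definition R_aff (R : fieldType) : lieAlgType R := lie3 (1 : R) 0 0 0.
Definition r3 (R : fieldType) (lambda : R) : lieAlgType R := lie3 1 0 0 lambda.
Definition r3' (R : fieldType) (eta : R) : lieAlgType R := lie3 eta (- 1) 1 eta.

Section Brackets.
Variable R : fieldType.

Lemma heis3_brackets :
  [/\ lie (e1 : heis3 R) e2 = e3, lie (e1 : heis3 R) e3 = 0 &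
      lie (e2 : heis3 R) e3 = 0].
Proof.
by have [-> -> ->] := lie3_brackets (0 : R) 1 0 0;
  rewrite !scale0r scale1r !add0r.
Qed.

Lemma R_aff_brackets :
  [/\ lie (e1 : R_aff R) e2 = e2, lie (e1 : R_aff R) e3 = 0 &
      lie (e2 : R_aff R) e3 = 0].
Proof.
by have [-> -> ->] := lie3_brackets (1 : R) 0 0 0;
  rewrite !scale0r scale1r !addr0.
Qed.

Lemma r3_brackets (lambda : R) :
  [/\ lie (e1 : r3 lambda) e2 = e2, lie (e1 : r3 lambda) e3 = lambda *: e3 &
      lie (e2 : r3 lambda) e3 = 0].
Proof.
by have [-> -> ->] := lie3_brackets 1 0 0 lambda;
  rewrite !scale0r scale1r addr0 add0r.
Qed.

Lemma r3'_brackets (eta : R) :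
  [/\ lie (e1 : r3' eta) e2 = eta *: e2 - e3,
      lie (e1 : r3' eta) e3 = e2 + eta *: e3 &
      lie (e2 : r3' eta) e3 = 0].
Proof.
by have [-> -> ->] := lie3_brackets eta (- 1) 1 eta;
  rewrite scaleN1r scale1r.
Qed.

End Brackets.

(* Main.v *)
(** Write h = R e_1 + V with V an abelian ideal of dimension two and A the
    action of e_1 on V; only A matters, up to conjugation and scaling, so one
    has to exclude A triangular with diagonal entries a, d such that a, d, a + d
    are non-zero and A is not scalar.  Then T*h = R e_1 + n, where
    n = V + V* + R z is a Heisenberg algebra with centre z, and e_1 acts on n/z
    as the direct sum D of A and -A^T, which has real spectrum and minimal
    polynomial of degree four.  Let J be a complex structure.  As z is central,
    ad(Jz) commutes with J.  If Jz were outside n, ad(Jz) would have a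
    one-dimensional real eigenspace, which J would preserve; so Jz is in n.
    Then z is in the image of ad(Jz), hence so is Jz, which makes Jz an
    eigenvector of D modulo z.  Put W = <z, Jz> and let M be the intersection of
    n and Jn; their dimensions are two and four.  D acts on n/M and on W/z by
    scalars k' and k, and commutes with J on the plane M/W, where it therefore
    acts as al + be J.  So (D - k)((D - al)^2 + be^2)(D - k') = 0 on n/z.
    Reality of the spectrum forces be = 0, and then the cubic
    (D - k)(D - al)(D - k') kills n/z, a contradiction. *)
From HB Require Import structures.
Require Import Defs.
From mathcomp Require Import all_boot all_order all_algebra.
From mathcomp Require Import ring lra zify.
Import Order.TTheory GRing.Theory Num.Theory.
Local Open Scope ring_scope.

Set Implicit Arguments.
Unset Strict Implicit.
Unset Printing Implicit Defensive.

(** * Linear algebra: adjoining a line, bases of three vectors *)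

Lemma dim_addv_line (R : fieldType) (V : vectType R) (U : {vspace V}) (v : V) :
  v \notin U -> \dim (U + <[v]>)%VS = (\dim U).+1.
Proof.
move=> vU; apply/eqP; rewrite eqn_leq; apply/andP; split.
  have [leUv _] := dimv_add_leqif U <[v]>; apply: (leq_trans leUv).
  by rewrite -addn1 leq_add2l dim_vline leq_b1.
rewrite (ltn_leqif (dimv_leqif_eq (addvSl _ _))); apply: contra vU.
by move=> /eqP ->; apply: (subvP (addvSr _ _)); apply: memv_line.
Qed.

Section Basis3.
Context {R : fieldType} {V : vectType R}.

Definition free3 (x y z : V) := forall k l m : R,
  k *: x + l *: y + m *: z = 0 -> [/\ k = 0, l = 0 & m = 0].

Lemma free3_basis (x y z : V) (dimV : \dim {:V} = 3%N) :
  free3 x y z -> basis_of {:V} [tuple x; y; z].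
Proof.
move=> xyz; rewrite basisEfree subvf dimV /= leqnn !andbT.
apply/(freeP (X := [tuple x; y; z])) => k.
rewrite !big_ord_recl big_ord0 addr0 /= addrA => /xyz[k0 k1 k2].
move=> [[|[|[|//]]] lti].
- by rewrite -[RHS]k0; congr k; apply: val_inj.
- by rewrite -[RHS]k1; congr k; apply: val_inj.
- by rewrite -[RHS]k2; congr k; apply: val_inj.
Qed.

Lemma free3_coord (x y z : V) :
  let X := [tuple x; y; z] in basis_of {:V} X ->
  [/\ forall v, v = coord X 0 v *: x + coord X 1 v *: y + coord X 2 v *: z,
      forall i, coord X i x = (0 == i)%:R,
      forall i, coord X i y = (1 == i)%:R &
      forall i, coord X i z = (2 == i)%:R].
Proof.
move=> X bX; have freeX := basis_free bX; split=> [v|i|i|i].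
- rewrite {1}(coord_basis bX (memvf v)) !big_ord_recl big_ord0 addr0 /= addrA.
  by do ?[congr (_ + _)]; congr (coord _ _ _ *: _); apply: val_inj.
- by rewrite -[x]/(X`_0%N) (coord_free (0 : 'I_3) i freeX).
- by rewrite -[y]/(X`_1%N) (coord_free (1 : 'I_3) i freeX).
- by rewrite -[z]/(X`_2%N) (coord_free (2 : 'I_3) i freeX).
Qed.

End Basis3.

(** * Solvable Lie algebras of dimension three as [lie3] algebras *)

Section Lie3Basis.
Context {R : fieldType} {h : lieAlgType R}.

Definition lie3_basis (a b c d : R) (x y z : h) :=
  [/\ free3 x y z, lie x y = a *: y + b *: z,
      lie x z = c *: y + d *: z & lie y z = 0].

Lemma lie3_iso (a b c d : R) (x y z : h) (dim_h : \dim {:h} = 3%N) :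
  lie3_basis a b c d x y z -> lie_isomorphic h (lie3 a b c d).
Proof.
case=> /(free3_basis dim_h) bX xy xz yz.
set X := [tuple x; y; z] in bX.
have freeX := basis_free bX.
pose f (v : h) : lie3 a b c d := \row_i coord X i v.
have f_lin : linear f by move=> k u v; apply/rowP => i; rewrite !mxE linearP.
pose fL := GRing.isLinear.Build R h (lie3 a b c d) *:%R f f_lin.
pose F : {linear h -> lie3 a b c d} := HB.pack f fL.
have [E _ cy cz] := free3_coord bX.
exists F; split.
  exists (fun r : lie3 a b c d => \sum_i r 0 i *: X`_i) => [v|r].
    rewrite [RHS](coord_basis bX (memvf v)); apply: eq_bigr => i _.
    by rewrite mxE.
  apply/rowP => i; rewrite mxE; exact: coord_sum_free.
move=> u v; rewrite [in LHS](E u) [in LHS](E v).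
rewrite !(lieDl, lieZl, linearD, linearZ) /=.
rewrite !liexx (lie_anti y x) (lie_anti z x) (lie_anti z y) xy xz yz.
apply/rowP => i; rewrite !mxE !(linearD, linearZ, linearN) /=.
rewrite !(linearD, linearZ, linearN, linear0) /= !cy !cz.
rewrite /GRing.scale /=.
case: i => [[|[|[|//]]] lti]; rewrite /=; ring.
Qed.

(** With A the matrix of rows (a, b), (c, d) and P that of rows (p, q), (r, w), the four equations
    are the entries of s P A = A' P: conjugation by P and scaling by s. *)
Lemma lie3_basis_change (a b c d a' b' c' d' s p q r w : R) (x y z : h) :
  s != 0 -> p * w - q * r != 0 ->
  s * (p * a + q * c) = a' * p + b' * r ->
  s * (p * b + q * d) = a' * q + b' * w ->
  s * (r * a + w * c) = c' * p + d' * r ->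
  s * (r * b + w * d) = c' * q + d' * w ->
  lie3_basis a b c d x y z ->
  lie3_basis a' b' c' d' (s *: x) (p *: y + q *: z) (r *: y + w *: z).
Proof.
move=> s0 det0 e1 e2 e3 e4 [xyz xy xz yz].
have E (k l m n o t : R) : k *: (l *: y + m *: z) + n *: (o *: y + t *: z)
    = (k * l + n * o) *: y + (k * m + n * t) *: z.
  by rewrite !scalerDr !scalerA addrACA -!scalerDl.
have L k l : lie x (k *: y + l *: z) = k *: lie x y + l *: lie x z.
  by rewrite linearD !linearZ.
split.
- move=> k l m; rewrite -addrA E addrA scalerA => /xyz[/eqP k0 l0 m0].
  move: k0; rewrite mulf_eq0 (negPf s0) orbF => /eqP->; split=> //.
    apply: (mulIf det0); rewrite mul0r.
    transitivity ((l * p + m * r) * w - (l * q + m * w) * r); first ring.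
    by rewrite l0 m0; ring.
  apply: (mulIf det0); rewrite mul0r.
  transitivity ((l * q + m * w) * p - (l * p + m * r) * q); first ring.
  by rewrite l0 m0; ring.
- by rewrite lieZl L xy xz !E -e1 -e2 scalerDr !scalerA.
- by rewrite lieZl L xy xz !E -e3 -e4 scalerDr !scalerA.
- rewrite !lieDl !lieZl !linearD !linearZ /= !liexx (lie_anti z y) yz.
  by rewrite oppr0 !scaler0 !addr0.
Qed.

(** Solvability makes the derived algebra proper, so it lies in a plane, and such a plane contains
    every bracket. *)
Lemma ideal_codim1 (dim_h : \dim {:h} = 3%N) :
  lie_solvable h -> exists x u v : h,
    free3 x u v /\ forall y z : h, exists k l, lie y z = k *: u + l *: v.
Proof.
move=> [n hn].
pose D : {vspace h} := lie_prodv fullv fullv.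
have : D != fullv.
  apply/eqP => DE.
  suff E m : derived_lie m = fullv :> {vspace h}.
    by move: dim_h; rewrite -(E n) hn dimv0.
  by elim: m => //= m ->.
rewrite eqEsubv subvf /= => /subvPn[x _ xD].
(* A hyperplane containing [D] and complementary to the line of [x]. *)
pose U := (D + (<[x]> + D)^C)%VS.
have xU : (<[x]> + U)%VS = fullv by rewrite addvA addv_complf.
have dimU : \dim U = 2%N.
  have dimx : (\dim <[x]> <= 1)%N by rewrite dim_vline leq_b1.
  have dimxD : \dim (<[x]> + D)%VS = (\dim D).+1.
    by rewrite addvC dim_addv_line.
  have := dimvS (subvf (<[x]> + D)%VS); rewrite dim_h => leD.
  have [ltU _] := dimv_add_leqif D (<[x]> + D)^C%VS.
  have [geU _] := dimv_add_leqif <[x]> U.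
  move: ltU geU; rewrite xU dimv_compl dim_h -/U; lia.
have xNU : x \notin U.
  apply/negP => xU1; move: dimU; have <- : fullv = U; last by rewrite dim_h.
  by rewrite -xU; apply/addv_idPr; rewrite -memvE.
have := vbasisP U; case: (vbasis U) => /= s; rewrite dimU.
case: s => [|u [|v []]] //= _ /andP[/eqP spanU].
rewrite !free_cons span_nil span_seq1 => /and3P[uv v0 _].
have inU y : reflect (exists k l, y = k *: u + l *: v) (y \in U).
  rewrite -spanU span_cons span_seq1.
  apply: (iffP memv_addP) => [|[k [l ->]]].
    by case=> _ /vlineP[k ->] [_ /vlineP[l ->] ->]; exists k, l.
  by exists (k *: u); [|exists (l *: v)]; rewrite // memvZ ?memv_line.
have Z y W k : y \notin (W : {vspace h}) -> k *: y \in W -> k = 0.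
  move=> yW kyW; apply/eqP; apply: contraR yW => k0.
  by rewrite -[y](scalerK k0) memvZ.
exists x, u, v; split=> [k l m E | y z].
  have k0 : k = 0.
    apply: Z xNU _; apply/inU; exists (- l), (- m).
    by apply/eqP; rewrite -subr_eq0 !scaleNr !opprD !opprK addrA E.
  move: E; rewrite k0 scale0r add0r => E.
  have l0 : l = 0.
    apply: Z uv _; apply/vlineP; exists (- m).
    by apply/eqP; rewrite -subr_eq0 !scaleNr opprK E.
  move: E; rewrite l0 scale0r add0r => /eqP.
  rewrite scaler_eq0 => /orP[/eqP->//|/eqP v00].
  by rewrite v00 mem0v in v0.
apply/inU; apply: (subvP (addvSl _ _)).
by apply: memv_lie; apply: memvf.
Qed.

(* If the codimension-one ideal <u, v> is not abelian, it is aff(R); since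
   derivations of aff(R) are inner, the algebra is then R x aff(R). *)
Lemma solvable_lie3_basis (dim_h : \dim {:h} = 3%N) :
  lie_solvable h -> exists a b c d x y z, lie3_basis a b c d x y (z : h).
Proof.
move=> /(ideal_codim1 dim_h)[x [u [v [xuv U]]]].
have [p [q uvE]] := U u v.
have [uv0|uv0] := eqVneq (lie u v) 0.
  have [a [b xu]] := U x u; have [c [d xv]] := U x v.
  by exists a, b, c, d, x, u, v.
(* For X = al u + be v one gets [X, [u, v]] = (al q - be p) [u, v]; determinant one makes [u, v] an
   eigenvector for 1. *)
have [X [al [be [XE det1]]]] :
    exists X al be, X = al *: u + be *: v /\ al * q - be * p = 1.
  have [q0|q0] := eqVneq q 0.
    have p0 : p != 0.
      by apply: contraNneq uv0 => p0; rewrite uvE q0 p0 !scale0r addr0.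
    exists (0 *: u + - p^-1 *: v), 0, (- p^-1); split=> //.
    by rewrite mulNr mulVf // mul0r sub0r opprK.
  exists (q^-1 *: u + 0 *: v), q^-1, 0; split=> //.
  by rewrite mulVf // mul0r subr0.
pose y := lie u v.
have Xy : lie X y = y.
  rewrite /y XE {1}uvE lieDl !lieZl !linearD !linearZ /= !liexx.
  rewrite (lie_anti v u) !scaler0 add0r addr0 scalerN !scalerA.
  rewrite scalerN scalerA -scaleNr -scalerDl mulrC [p * be]mulrC det1.
  by rewrite scale1r.
have E (k l m n o t : R) : k *: (l *: u + m *: v) + n *: (o *: u + t *: v)
    = (k * l + n * o) *: u + (k * m + n * t) *: v.
  by rewrite !scalerDr !scalerA addrACA -!scalerDl.
have free : free3 x X y.
  move=> k l m; rewrite /y uvE XE -addrA E addrA => /xuv[-> l0 m0].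
  split=> //.
    transitivity ((l * al + m * p) * q - (l * be + m * q) * p).
      by rewrite -[l in LHS]mulr1 -det1; ring.
    by rewrite l0 m0; ring.
  transitivity ((l * be + m * q) * al - (l * al + m * p) * be).
    by rewrite -[m in LHS]mulr1 -det1; ring.
  by rewrite l0 m0; ring.
have {}U w t : exists k l, lie w t = k *: X + l *: y.
  have [k [l ->]] := U w t; exists (k * q - l * p), (l * al - k * be).
  rewrite /y uvE XE E; congr (_ *: _ + _ *: _).
    by rewrite -[LHS]mulr1 -det1; ring.
  by rewrite -[LHS]mulr1 -det1; ring.
have [g [dl xX]] := U x X; have [mu [nu xy]] := U x y.
(* The Jacobi identity on [x], [X], [y] reads mu X - g y = 0. *)
have [_ mu0 g0] : [/\ (0 : R) = 0, mu = 0 & - g = 0].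
  apply: free; rewrite scale0r add0r.
  have := lie_jacobi x X y.
  rewrite Xy (lie_anti y x) xy xX linearN !linearD !linearZ /= !liexx.
  rewrite (lie_anti y X) Xy oppr0 !scaler0 add0r addr0 !scalerN => <-.
  by rewrite addrK scaleNr.
move: xX xy; rewrite mu0 -[g]opprK g0 oppr0 !scale0r !add0r => xX xy.
have L w : lie w (x - nu *: X + dl *: y)
    = lie w x - nu *: lie w X + dl *: lie w y.
  by rewrite linearD linearB !linearZ.
(* On the plane, [x] acts as nu X - dl y does, so the third vector is central. *)
exists 1, 0, 0, 0, X, y, (x - nu *: X + dl *: y); split.
- move=> k l m H.
  have [] := free m (k - m * nu) (l + m * dl).
    rewrite -[RHS]H !(scalerDr, scalerDl, scalerN, scaleNr, scalerA).
    by rewrite [RHS](AC (2*3) ((3*(1*4))*(2*5))).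
  by move=> -> ; rewrite !mul0r subr0 addr0.
- by rewrite Xy scale1r scale0r addr0.
- rewrite L liexx scaler0 subr0 Xy.
  by rewrite (lie_anti X x) xX addNr !scale0r addr0.
- rewrite L liexx scaler0 addr0.
  by rewrite (lie_anti y x) (lie_anti y X) Xy xy scalerN subrr.
Qed.

Lemma lie3_basis_neq0 (a b c d : R) (x y z : h) (dim_h : \dim {:h} = 3%N) :
  ~ lie_abelian h -> lie3_basis a b c d x y z ->
  ~ [/\ a = 0, b = 0, c = 0 & d = 0].
Proof.
move=> nab [/(free3_basis dim_h) bX xy xz yz] [a0 b0 c0 d0]; apply: nab => u v.
rewrite (coord_basis bX (memvf u)) (coord_basis bX (memvf v)).
rewrite !big_ord_recl !big_ord0 !addr0 /= !(lieDl, lieZl, linearD, linearZ) /=.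
rewrite !liexx (lie_anti y x) (lie_anti z x) (lie_anti z y) xy xz yz.
by rewrite a0 b0 c0 d0 !scale0r !addr0 !oppr0 !scaler0 !addr0.
Qed.

End Lie3Basis.

(** The numbers a and -a are distinct, hence exhaust k and k'; as d differs from -a, it is a. This
    serves the case be != 0, where the real eigenvalues of D can only be k or k'. *)
Lemma opposite_roots (R : realFieldType) (a d k k' : R) :
  a + a != 0 -> a + d != 0 -> a = k \/ a = k' -> - a = k \/ - a = k' ->
  d = k \/ d = k' -> k + k' = 0 /\ a = d.
Proof.
move=> aa0 ad0 [] e1 [] e2 [] e3;
  first [by split; lra | case/eqP: aa0; lra | case/eqP: ad0; lra].
Qed.

(** * Subspaces stable under a map of square -1 *)

Section AlmostComplex.
Context {R : realFieldType} {V : vectType R} (J : 'End(V)).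
Context (JJ : forall x, J (J x) = - x).

Lemma sqr_add1_neq0 (k : R) : 1 + k ^+ 2 != 0.
Proof. by rewrite gt_eqF // ltr_wpDr ?sqr_ge0. Qed.

(** Modulo the stable subspace [U], (J + k)(J - k) = -(1 + k^2) is invertible over an ordered
    field. *)
Lemma complex_no_eigenvector (U : {vspace V}) (v : V) (k : R) :
  (J @: U <= U)%VS -> J v - k *: v \in U -> v \in U.
Proof.
move=> JU Uv; rewrite -[v](scalerK (sqr_add1_neq0 k)) memvZ //.
rewrite -memvN; suff -> : - ((1 + k ^+ 2) *: v)
  = J (J v - k *: v) + k *: (J v - k *: v).
  by rewrite memvD ?memvZ //; apply: (subvP JU); apply: memv_img.
have -> : J (J v - k *: v) = - v - k *: J v by rewrite linearB linearZ /= JJ.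
rewrite scalerBr scalerA -expr2 addrA subrK.
by rewrite scalerDl scale1r opprD.
Qed.

(** [J v] stays outside U + <v>, since otherwise [v] would be an eigenvector modulo [U]. Iterating
    gives a stable flag of dimensions 0, 2, 4, 6. *)
Lemma complex_adjoin (U : {vspace V}) (v : V) :
  (J @: U <= U)%VS -> v \notin U ->
  let U' := (U + <[v]> + <[J v]>)%VS in
  (J @: U' <= U')%VS /\ \dim U' = (\dim U).+2.
Proof.
move=> JU vU U'; split.
  have sU : (U <= U')%VS by rewrite /U' -addvA addvSl.
  have vU' : v \in U'.
    by rewrite memvE (subv_trans (addvSr U _) (addvSl _ _)).
  have JvU' : J v \in U' by rewrite memvE addvSr.
  rewrite {1}/U' !limgD !subv_add !limg_line JJ (subv_trans JU sU) /=.
  by rewrite -!memvE memvN JvU' vU'.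
rewrite !dim_addv_line //; apply: contra vU.
move=> /memv_addP[w wU [_ /vlineP[k ->] Jv]].
by apply: (@complex_no_eigenvector _ _ k) => //; rewrite Jv addrK.
Qed.

End AlmostComplex.

(** * A complex structure on T*h for triangular A, in coordinates *)

Section TriangularCotangent.
Context {R : realFieldType} {g : lieAlgType R} {a c d : R}.
(* Coordinates on T*h: t along e_1; v1, v2 along V; p1, p2 along V*; q along the
   dual vector z of e_1. *)
Context {t v1 v2 p1 p2 q : {scalar g}} {z : g}.
Context (coord_inj : forall x y, t x = t y -> v1 x = v1 y -> v2 x = v2 y ->
  p1 x = p1 y -> p2 x = p2 y -> q x = q y -> x = y).
Context (coord_surj : forall k0 k1 k2 k3 k4 k5, exists x,
  [/\ t x = k0, v1 x = k1 & v2 x = k2] /\ [/\ p1 x = k3, p2 x = k4 & q x = k5]).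
Context (zE : [/\ t z = 0, v1 z = 0 & v2 z = 0] /\
  [/\ p1 z = 0, p2 z = 0 & q z = 1]).
Context (lie_t : forall x y, t (lie x y) = 0).
Context (lie_v1 : forall x y,
  v1 (lie x y) = t x * (a * v1 y + c * v2 y) - t y * (a * v1 x + c * v2 x)).
Context (lie_v2 : forall x y, v2 (lie x y) = d * (t x * v2 y - t y * v2 x)).
Context (lie_p1 : forall x y, p1 (lie x y) = - a * (t x * p1 y - t y * p1 x)).
Context (lie_p2 : forall x y,
  p2 (lie x y) = - t x * (c * p1 y + d * p2 y) + t y * (c * p1 x + d * p2 x)).
Context (lie_q : forall x y, q (lie x y) = a * (v1 x * p1 y - v1 y * p1 x)
  + c * (v2 x * p1 y - v2 y * p1 x) + d * (v2 x * p2 y - v2 y * p2 x)).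
Context (a0 : a != 0) (d0 : d != 0) (ad0 : a + d != 0).
Context (nscalar : a = d -> c != 0).
Context (dim_g : \dim {:g} = 6%N) {J : 'End(g)} (cJ : complex_structure J).

Let lieE := (lie_t, lie_v1, lie_v2, lie_p1, lie_p2, lie_q).

Let tz : t z = 0. Proof. by case: zE => [[]]. Qed.
Let v1z : v1 z = 0. Proof. by case: zE => [[]]. Qed.
Let v2z : v2 z = 0. Proof. by case: zE => [[]]. Qed.
Let p1z : p1 z = 0. Proof. by case: zE => [_ []]. Qed.
Let p2z : p2 z = 0. Proof. by case: zE => [_ []]. Qed.
Let qz : q z = 1. Proof. by case: zE => [_ []]. Qed.
Let zC := (tz, v1z, v2z, p1z, p2z, qz).

Let z0 : z != 0.
Proof. by apply: contra_eq_neq qz => ->; rewrite linear0 eq_sym oner_neq0. Qed.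

Let JJ x : J (J x) = - x. Proof. by case: cJ. Qed.

Let noeig (x : g) (k : R) : J x = k *: x -> x = 0.
Proof.
move=> Jx; apply/eqP; rewrite -memv0.
apply: (complex_no_eigenvector JJ (k := k)).
  by rewrite limg0.
by rewrite Jx subrr mem0v.
Qed.

Let lie_z x : lie z x = 0.
Proof. by apply: coord_inj; rewrite !lieE ?zC linear0; ring. Qed.

Let liez x : lie x z = 0.
Proof. by rewrite lie_anti lie_z oppr0. Qed.

Let Jz_comm x : lie (J z) (J x) = J (lie (J z) x).
Proof.
have := cJ.2 z x; rewrite !lie_z (linear0 J) !subr0 => /eqP.
by rewrite subr_eq0 => /eqP.
Qed.

Let lie_nil x y : t x = 0 -> t y = 0 -> lie x y = q (lie x y) *: z.
Proof.
by move=> tx ty; apply: coord_inj;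
   rewrite linearZ /= ?zC ?lieE ?tx ?ty; ring.
Qed.

Let tJz : t (J z) = 0.
Proof.
apply/eqP; apply: contraT => s0; set s := t (J z) in s0.
(* x spans the eigenspace of ad(Jz) for the eigenvalue s a. *)
have [x [[tx v1x v2x] [p1x p2x qx]]] := coord_surj 0 1 0 0 0 (- p1 (J z) / s).
have ex : lie (J z) x = (s * a) *: x.
  apply: coord_inj;
    rewrite linearZ /= lieE -?/s ?tx ?v1x ?v2x ?p1x ?p2x ?qx; try ring.
  by field.
have := Jz_comm x; rewrite ex linearZ /=; set w := J x => ew.
have sa0 : s * a != 0 by rewrite mulf_neq0.
have tw : t w = 0.
  by move/(congr1 t): ew; rewrite linearZ lie_t /= => /esym/eqP;
    rewrite mulf_eq0 (negPf sa0) => /eqP.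
(* If a = d, then c != 0 gives a Jordan block and the [v1] equation kills [v2 w]; otherwise d is a
   different eigenvalue and the [v2] equation does. *)
have v2w : v2 w = 0.
  move/(congr1 v1): (ew); move/(congr1 v2): (ew).
  rewrite !linearZ /= !lieE tw -/s => e2 e1.
  have [/nscalar c0|ad] := eqVneq a d.
    by apply: (mulfI (mulf_neq0 s0 c0)); lra.
  have ad' : s * (d - a) != 0 by rewrite mulf_neq0 // subr_eq0 eq_sym.
  by apply: (mulfI ad'); lra.
have p1w : p1 w = 0.
  move/(congr1 p1): (ew); rewrite !linearZ /= !lieE tw -/s => e1.
  have : s * a * p1 w = 0 by lra.
  by move/eqP; rewrite mulf_eq0 (negPf sa0) => /eqP.
have p2w : p2 w = 0.
  move/(congr1 p2): (ew); rewrite !linearZ /= !lieE tw p1w -/s => e1.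
  have : s * (a + d) * p2 w = 0 by lra.
  by move/eqP; rewrite !mulf_eq0 (negPf s0) (negPf ad0) /= => /eqP.
have : w = v1 w *: x.
  apply: coord_inj; rewrite linearZ /= ?tx ?v1x ?v2x ?p1x ?p2x ?qx
    ?tw ?v2w ?p1w ?p2w ?mulr0 ?mulr1 //.
  move/(congr1 q): (ew); rewrite !linearZ /= !lieE p1w p2w v2w => e1.
  by apply: (mulfI sa0); rewrite -e1; field.
move/noeig => x0; move: v1x; rewrite x0 linear0 => /eqP.
by rewrite eq_sym oner_eq0.
Qed.

(** As a and d are non-zero, the bracket is a non-degenerate form on n/z, and [J z] is non-zero
    there because it is no multiple of [z]. The witnesses pair with one non-zero coordinate of
    [J z]. *)
Let lie_Jz_onto : exists x, lie (J z) x = z.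
Proof.
suff [k1 [k2 [k3 [k4 H]]]] : exists k1 k2 k3 k4,
    a * (v1 (J z) * k3 - k1 * p1 (J z)) + c * (v2 (J z) * k3 - k2 * p1 (J z))
      + d * (v2 (J z) * k4 - k2 * p2 (J z)) = 1.
  have [x [[tx v1x v2x] [p1x p2x qx]]] := coord_surj 0 k1 k2 k3 k4 0.
  exists x; apply: coord_inj;
    rewrite ?zC lieE ?tJz ?tx ?v1x ?v2x ?p1x ?p2x; try ring.
  exact: H.
have [e2|n2] := eqVneq (v2 (J z)) 0; last first.
  by exists 0, 0, 0, (d * v2 (J z))^-1; field; rewrite n2.
have [e1|n1] := eqVneq (v1 (J z)) 0; last first.
  by exists 0, 0, (a * v1 (J z))^-1, 0; rewrite e2; field; rewrite n1.
have [e3|n3] := eqVneq (p1 (J z)) 0; last first.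
  by exists (- (a * p1 (J z))^-1), 0, 0, 0; field; rewrite n3.
have [e4|n4] := eqVneq (p2 (J z)) 0; last first.
  by exists 0, (- (d * p2 (J z))^-1), 0, 0; rewrite e3; field; rewrite n4.
have /noeig : J z = q (J z) *: z.
  by apply: coord_inj; rewrite linearZ /= ?zC ?tJz ?e1 ?e2 ?e3 ?e4; ring.
by move/eqP; rewrite (negPf z0).
Qed.

(** Applying J to [Jz, x] = z gives [Jz, Jx] = Jz. With Jx = s X + n, the part n of t-coordinate 0
    contributes only a multiple of z, and s = 0 would make z an eigenvector of J. *)
Let Jz_eigen X : t X = 1 -> exists k l, lie X (J z) = k *: J z + l *: z.
Proof.
move=> tX; have [x ex] := lie_Jz_onto.
have := Jz_comm x; rewrite ex; set s := t (J x) => e.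
have [n [tn Jx]] : exists n, t n = 0 /\ J x = s *: X + n.
  by exists (J x - s *: X); rewrite subrKC linearB linearZ /= tX mulr1 subrr.
rewrite Jx linearD linearZ /= (lie_nil tJz tn) in e.
set l := q _ in e.
have s0 : s != 0.
  apply: contraNneq z0 => s0; apply/eqP; apply: (noeig (k := l)).
  by rewrite -e s0 scale0r add0r.
exists (- s^-1), (s^-1 * l).
rewrite lie_anti -[lie (J z) X](scalerK s0).
have -> : s *: lie (J z) X = J z - l *: z by rewrite -[in RHS]e addrK.
by rewrite scalerBr opprB scalerA scaleNr addrC.
Qed.

(** The hyperplane n = ker t has odd dimension, so J cannot preserve it. Explicitly, projecting
    [J E] to n along [E] gives x with t (J x) = -(1 + t (J E)^2). *)
Let exists_J_transversal : exists u, t u = 0 /\ t (J u) = 1.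
Proof.
have [E [[tE _ _] _]] := coord_surj 1 0 0 0 0 0.
pose x := J E - t (J E) *: E.
have tx : t x = 0 by rewrite linearB linearZ /= tE mulr1 subrr.
have tJx : t (J x) != 0.
  have -> : t (J x) = - (1 + t (J E) ^+ 2).
    by rewrite /x !(linearB, linearZ) /= JJ linearN tE; ring.
  by rewrite oppr_eq0 sqr_add1_neq0.
exists ((t (J x))^-1 *: x).
by rewrite linearZZ !scalarZ tx mulr0 mulVf.
Qed.

Let lie_shift (X : g) (al r s : R) (y y' : g) :
  lie X (r *: y + s *: y') - al *: (r *: y + s *: y')
  = r *: (lie X y - al *: y) + s *: (lie X y' - al *: y').
Proof.
have -> : lie X (r *: y + s *: y') = r *: lie X y + s *: lie X y'.
  by rewrite linearD !linearZ.
by rewrite !scalerBr scalerDr opprD addrACA !scalerA ![al * _]mulrC.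
Qed.

(** These are the annihilating polynomials of D = ad X on n/z. When be = 0, D - al already sends M
    into W, so one factor suffices in place of the quadratic one. *)
Let annihilators : exists X k k' al be,
  [/\ t X = 1,
    forall x, t x = 0 -> let y := lie X x - k' *: x in
      let w := lie X (lie X y - al *: y) - al *: (lie X y - al *: y)
               + be ^+ 2 *: y in
      exists l, lie X w - k *: w = l *: z &
    be = 0 -> forall x, t x = 0 -> let y := lie X x - k' *: x in
      let w := lie X y - al *: y in
      exists l, lie X w - k *: w = l *: z].
Proof.
have [u [tu tJu]] := exists_J_transversal.
pose X := J u; have [k [l0 Dy0]] := Jz_eigen tJu.
pose W := (<[z]> + <[J z]>)%VS.
have zW : z \in W by rewrite memvE addvSl.
have JzW : J z \in W by rewrite memvE addvSr.
have inW y : y \in W -> exists r s, y = r *: z + s *: J z.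
  by move=> /memv_addP[_ /vlineP[r ->] [_ /vlineP[s ->] ->]]; exists r, s.
have [JW dimW] : (J @: W <= W)%VS /\ \dim W = 2%N.
  have := @complex_adjoin _ _ _ JJ 0%VS z; rewrite limg0 subvv memv0 z0 add0v.
  by rewrite dimv0; apply.
have DW y : y \in W -> lie X y \in W.
  move=> /inW[r [s ->]]; rewrite linearD !linearZ /= liez scaler0 add0r.
  by rewrite Dy0 memvZ // memvD ?memvZ.
have kW y : y \in W -> exists l, lie X y - k *: y = l *: z.
  move=> /inW[r [s ->]]; exists (s * l0 - k * r).
  have -> : lie X (r *: z + s *: J z) = s *: lie X (J z).
    by rewrite linearD !linearZ /= liez scaler0 add0r.
  rewrite Dy0 !scalerDr !scalerA.
  by rewrite [s * k]mulrC [_ *: z + _]addrC opprD addrACA subrr add0r -scalerBl.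
pose M y := t y = 0 /\ t (J y) = 0.
have MW y : y \in W -> M y.
  move=> /inW[r [s ->]].
  by split; rewrite !(linearD, linearZZ, scalarZ) /= ?JJ ?linearN tz tJz; ring.
(* Since u, y and J y lie in n, [u, y] and [u, Jy] are multiples of z; integrability at u, y then
   says that D = ad (J u) commutes with J modulo W. *)
have DJ y : M y -> lie X (J y) - J (lie X y) \in W.
  move=> [ty tJy]; have := cJ.2 u y; rewrite (lie_nil tu ty) (lie_nil tu tJy).
  rewrite -/X [J (_ *: z)]linearZZ => /eqP.
  rewrite subr_eq0 addrAC subr_eq => /eqP ->.
  by rewrite addrC memvD ?memvZ.
have DM y : M y -> M (lie X y).
  move=> My; split; first exact: lie_t.
  have [+ _] := MW _ (DJ _ My).
  by rewrite linearB lie_t sub0r => /eqP; rewrite oppr_eq0 => /eqP.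
have MB y y' : M y -> M y' -> M (y - y').
  move=> [ty tJy] [ty' tJy'].
  by split; rewrite !linearB /= ?ty ?ty' ?tJy ?tJy' subrr.
have MZ r y : M y -> M (r *: y).
  move=> [ty tJy].
  by split; rewrite ?linearZZ scalarZ ?ty ?tJy mulr0.
have MD y y' : M y -> M y' -> M (y + y').
  by move=> My /(MZ (-1)) /(MB _ _ My); rewrite scaleN1r opprK.
have [m [Mm Mspan]] : exists m, M m /\
    forall y, M y -> exists2 w, w \in W &
    exists r s, y = w + r *: m + s *: J m.
  have uW : u \notin W.
    by apply/negP => /MW[_]; rewrite tJu => /eqP; rewrite oner_eq0.
  have [] := complex_adjoin JJ JW uW; set U := (_ + <[J u]>)%VS => JU dimU.
  have uU : u \in U by rewrite memvE (subv_trans (addvSr W _) (addvSl _ _)).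
  have XU : X \in U by rewrite memvE addvSr.
  have [m0 _ m0U] : exists2 m0, m0 \in fullv & m0 \notin U.
    by apply/subvPn; apply/negP => /dimvS; rewrite dim_g dimU dimW.
  (* As t X = 1 = t (J u) and t u = 0 = t (J X), the two corrections bring [m0] into M without
     changing its class modulo [U]. *)
  pose m := m0 - t m0 *: X - t (J m0) *: u.
  have mU : m \notin U.
    apply: contra m0U => mU.
    have -> : m0 = m + t (J m0) *: u + t m0 *: X by rewrite /m !subrK.
    by apply: memvD; [apply: memvD; rewrite // memvZ | rewrite memvZ].
  have [] := complex_adjoin JJ JU mU; set V := (_ + <[J m]>)%VS => _ dimV.
  have VE : V = fullv.
    by apply/eqP; rewrite eqEdim subvf dim_g dimV dimU dimW.
  have Mm : M m.
    split; first by rewrite /m !(linearB, scalarZ) /= tJu tu; ring.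
    by rewrite /m !(linearB, linearZZ, scalarZ) /= JJ linearN tJu tu; ring.
  clearbody m; exists m; split=> // y [ty tJy].
  have : y \in V by rewrite VE memvf.
  case/memv_addP => y1 /memv_addP[y2 /memv_addP[y3 /memv_addP[w wW]]].
  move=> [_ /vlineP[r ->] ->] [_ /vlineP[r' ->] ->] [_ /vlineP[s ->] ->].
  move=> [_ /vlineP[s' ->] yE].
  have [tw tJw] := MW _ wW; have [tm tJm] := Mm.
  have r'0 : r' = 0.
    by rewrite -[RHS]ty yE !(linearD, scalarZ) /= tw tu tJu tm tJm; ring.
  have r0 : r = 0.
    rewrite -[RHS]tJy yE !(linearD, linearZZ, scalarZ) /= !JJ !linearN.
    by rewrite tJw tJm tJu tu tm; ring.
  by exists w => //; exists s, s'; rewrite yE r0 r'0 !scale0r !addr0.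
have [w0 w0W [al [be Dm]]] := Mspan _ (DM _ Mm).
(* The functional x |-> t (J x) identifies n/M with R and sends [u] to 1, so [k'] is the scalar by
   which D acts on n/M. *)
pose k' := t (J (lie X u)).
have k'M x : t x = 0 -> M (lie X x - k' *: x).
  move=> tx; pose m1 := x - t (J x) *: u.
  have Mm1 : M m1.
    by split; rewrite /m1 !(linearB, linearN, linearZZ, scalarZ) /=
      ?tx ?tu ?tJu; ring.
  have Mu : M (lie X u - k' *: u).
    by split; rewrite !(linearB, linearN, linearZZ, scalarZ) /=
      ?lie_t ?tu ?tJu -/k'; ring.
  have -> : x = t (J x) *: u + m1 by rewrite /m1 subrKC.
  rewrite -[m1]scale1r lie_shift; apply: MD; apply/MZ=> //.
  by apply: MB; [exact: DM | exact: MZ].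
pose L y := lie X y - al *: y.
have LD r s y y' : L (r *: y + s *: y') = r *: L y + s *: L y'.
  exact: lie_shift.
have LW y : y \in W -> L y \in W by move=> yW; rewrite memvB ?DW ?memvZ.
(* On M/W, with basis [m], [J m], the map [L] is be J, hence its square is -be^2. *)
have Lm : L m - be *: J m \in W.
  by rewrite /L Dm addrAC addrK addrK.
have LJm : L (J m) + be *: m \in W.
  have := DJ _ Mm; rewrite Dm.
  have -> : J (w0 + al *: m + be *: J m) = J w0 + al *: J m - be *: m.
    by rewrite !linearD !linearZZ /= JJ.
  have JwW : J w0 \in W by apply: (subvP JW); apply: memv_img.
  move=> H; have := memvD H JwW; rewrite !opprD opprK.
  by rewrite (AC (1*3*1) ((1*3*4)*(2*5))) /= addNr addr0.
have LE y : L y = lie X y - al *: y by [].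
clearbody L.
have sq r : r * r = r ^+ 2 by rewrite expr2.
have LLm : L (L m) + be ^+ 2 *: m \in W.
  have := memvD (LW _ Lm) (memvZ be LJm).
  have := LD 1 (- be) (L m) (J m); rewrite !scale1r !scaleNr => ->.
  by rewrite scalerDr scalerA sq addrA subrK.
have LLJm : L (L (J m)) + be ^+ 2 *: J m \in W.
  have := memvB (LW _ LJm) (memvZ be Lm).
  have := LD 1 be (L (J m)) m; rewrite !scale1r => ->.
  by rewrite scalerBr scalerA sq opprB addrACA subrr addr0.
have L3 w1 r s : L (w1 + r *: m + s *: J m) = L w1 + r *: L m + s *: L (J m).
  have := LD 1 1 w1 (r *: m + s *: J m).
  by rewrite !scale1r LD !addrA.
have LL3 w1 r s : L (L w1 + r *: L m + s *: L (J m))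
    = L (L w1) + r *: L (L m) + s *: L (L (J m)).
  have := LD 1 1 (L w1) (r *: L m + s *: L (J m)).
  by rewrite !scale1r LD !addrA.
exists X, k, k', al, be; split=> // [x /k'M My y w|be0 x /k'M My y w].
  apply: kW; rewrite /w -!LE; clear w.
  have {}My : M y := My; clearbody y.
  have [w1 w1W [r [s ->]]] := Mspan _ My; rewrite L3 LL3 !scalerDr.
  rewrite ![be ^+ 2 *: (_ *: _)]scalerA ![be ^+ 2 * _]mulrC.
  rewrite -!(scalerA _ (be ^+ 2)).
  rewrite (AC (3*3) ((1*4)*(2*5)*(3*6))) /= -!scalerDr.
  by rewrite memvD ?memvD ?memvZ ?LW ?LW.
apply: kW; rewrite /w -LE; clear w.
  have {}My : M y := My; clearbody y.
have [w1 w1W [r [s ->]]] := Mspan _ My; rewrite L3.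
move: Lm LJm; rewrite be0 !scale0r subr0 addr0 => Lm' LJm'.
by rewrite memvD ?memvD ?memvZ ?(LW _ w1W).
Qed.

(** * Evaluating the annihilating polynomials at the eigenvalues of D *)

Let lie_shift_coord X k x : t X = 1 -> t x = 0 -> let y := lie X x - k *: x in
  [/\ t y = 0, v1 y = (a - k) * v1 x + c * v2 x, v2 y = (d - k) * v2 x,
      p1 y = (- a - k) * p1 x & p2 y = (- d - k) * p2 x - c * p1 x].
Proof.
by move=> tX tx y; split; rewrite /y linearB scalarZ lieE /= ?tX ?tx; ring.
Qed.

Lemma triangular_cotangent_no_complex : False.
Proof.
have [X [k [k' [al [be [tX Q4 Q3]]]]]] := annihilators.
have aa0 : a + a != 0 by rewrite -mulr2n mulrn_eq0.
have [x1 [[t1 x11 x12] [x13 x14 _]]] := coord_surj 0 1 0 0 0 0.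
have [x2 [[t2 x21 x22] [x23 x24 _]]] := coord_surj 0 0 1 0 0 0.
have [x3 [[t3 x31 x32] [x33 x34 _]]] := coord_surj 0 0 0 1 0 0.
have [x4 [[t4 x41 x42] [x43 x44 _]]] := coord_surj 0 0 0 0 1 0.
have be0 : be = 0.
  (* The coordinates of r(D) x vanish for x in n. The diagonal entries are values of r; the factor
     of c is its divided difference between a and d, that is r'(a) when a = d. *)
  pose r s := (s - k) * ((s - al) ^+ 2 + be ^+ 2) * (s - k').
  have rQ x : t x = 0 -> [/\ r d * v2 x = 0, r (- a) * p1 x = 0,
      p1 x = 0 -> r (- d) * p2 x = 0 &
      r a * v1 x + c * v2 x * ((a - k) * ((a - al) ^+ 2 + be ^+ 2)
       + (d - k') * ((a - k) * (a + d - 2 * al)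
         + (d - al) ^+ 2 + be ^+ 2)) = 0].
    move=> tx; have [l] := Q4 x tx; rewrite /=.
    have := lie_shift_coord k' tX tx; rewrite /=.
    move: (lie X x - k' *: x) => y [ty v1y v2y p1y p2y].
    have := lie_shift_coord al tX ty; rewrite /=.
    move: (lie X y - al *: y) => y' [ty' v1y' v2y' p1y' p2y'].
    have := lie_shift_coord al tX ty'; rewrite /=.
    move: (lie X y' - al *: y') => y2 [ty2 v1y2 v2y2 p1y2 p2y2].
    have tw : t (y2 + be ^+ 2 *: y) = 0.
      by rewrite linearD scalarZ /= ty2 ty mulr0 addr0.
    have := lie_shift_coord k tX tw; rewrite /=.
    move: (lie X _ - _) => w [_ v1w v2w p1w p2w] e; move: v1w v2w p1w p2w.
    rewrite e !scalarZ v1z v2z p1z p2z mulr0 !linearD !scalarZ /=.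
    move=> v1w v2w p1w p2w.
    rewrite /r; split.
    - by rewrite [RHS]v2w v2y2 v2y' v2y; ring.
    - by rewrite [RHS]p1w p1y2 p1y' p1y; ring.
    - by move=> p1x; rewrite [RHS]p2w p2y2 p1y2 p2y' p1y' p2y p1y p1x; ring.
    - by rewrite [RHS]v1w v1y2 v2y2 v1y' v2y' v1y v2y; ring.
  have [_ _ _] := rQ _ t1; rewrite x11 x12 mulr1 mulr0 mul0r addr0 => ra.
  have [] := rQ _ t2; rewrite x21 x22 !mulr1 mulr0 add0r => rd _ _ rda.
  have [_] := rQ _ t3; rewrite x33 mulr1 => rNa _ _.
  have [_ _ +] := rQ _ t4; rewrite x44 mulr1 => /(_ x43) rNd _.
  apply/eqP/contraT => be0.
  have P s : (s - al) ^+ 2 + be ^+ 2 != 0.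
    by rewrite gt_eqF // ltr_wpDl ?sqr_ge0 // exprn_even_gt0.
  have root s : r s = 0 -> s = k \/ s = k'.
    move/eqP; rewrite !mulf_eq0 (negPf (P s)) orbF !subr_eq0.
    by case/orP => /eqP; [left | right].
  have [kk' ad] := opposite_roots aa0 ad0 (root _ ra) (root _ rNa) (root _ rd).
  move: rda; rewrite -ad => /eqP.
  rewrite mulf_eq0 (negPf (nscalar ad)) /= => /eqP.
  have : (a - k) * (a - k') = 0.
    by case: (root _ ra) => <-; rewrite subrr ?mul0r ?mulr0.
  set Q := (a - al) ^+ 2 + be ^+ 2 => e1 e2.
  (* [e2] says r'(a) = 0; with (a - k)(a - k') = 0 and k + k' = 0 it reduces to 2 a Q = 0. *)
  have /eqP : (a + a) * Q = 0.
    transitivity ((a - k) * Q + (a - k') * ((a - k) * (a + a - 2 * al)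
        + (a - al) ^+ 2 + be ^+ 2)
      - (a + a - 2 * al) * ((a - k) * (a - k')) + (k + k') * Q).
      by rewrite /Q; ring.
    by rewrite e1 e2 kk'; ring.
  by rewrite mulf_eq0 (negPf aa0) (negPf (P a)).
have {}Q3 := Q3 be0; pose r s := (s - k) * (s - al) * (s - k').
have rQ x : t x = 0 -> [/\ r d * v2 x = 0, r (- a) * p1 x = 0,
    r (- d) * p2 x
      - c * p1 x * ((- d - k) * (- d - al - a - k') + (a + al) * (a + k')) = 0 &
    r a * v1 x
      + c * v2 x * ((a - k) * (a - al + d - k') + (d - al) * (d - k')) = 0].
  move=> tx; have [l] := Q3 x tx; rewrite /=.
  have := lie_shift_coord k' tX tx; rewrite /=.
  move: (lie X x - k' *: x) => y [ty v1y v2y p1y p2y].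
  have := lie_shift_coord al tX ty; rewrite /=.
  move: (lie X y - al *: y) => y' [ty' v1y' v2y' p1y' p2y'].
  have := lie_shift_coord k tX ty'; rewrite /=.
  move: (lie X _ - _) => w [_ v1w v2w p1w p2w] e; move: v1w v2w p1w p2w.
  rewrite e !scalarZ v1z v2z p1z p2z mulr0 => v1w v2w p1w p2w.
  rewrite /r; split.
  - by rewrite [RHS]v2w v2y' v2y; ring.
  - by rewrite [RHS]p1w p1y' p1y; ring.
  - by rewrite [RHS]p2w p1y' p2y' p2y p1y; ring.
  - by rewrite [RHS]v1w v1y' v2y' v1y v2y; ring.
have [_ _ _] := rQ _ t1; rewrite x11 x12 mulr1 mulr0 mul0r addr0 => ra.
have [] := rQ _ t2; rewrite x21 x22 !mulr1 mulr0 add0r => rd _ _ rda.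
have [_] := rQ _ t3; rewrite x33 x34 !mulr1 mulr0 add0r => rNa rNda _.
have [_ _ +] := rQ _ t4; rewrite x44 x43 mulr1 mulr0 mul0r subr0 => rNd _.
(* The odd part of the cubic r vanishes at a, because r(a) = r(-a) = 0; dividing it by a leaves this
   relation. The same holds for d. *)
have ea : a ^+ 2 = - (k * al + al * k' + k * k').
  by apply: (mulfI aa0); move: ra rNa; rewrite /r => e1 e2; lra.
have ed : d ^+ 2 = - (k * al + al * k' + k * k').
  have dd0 : d + d != 0 by rewrite -mulr2n mulrn_eq0.
  by apply: (mulfI dd0); move: rd rNd; rewrite /r => e1 e2; lra.
have ad : a = d.
  have /eqP : (a - d) * (a + d) = 0 by lra.
  by rewrite mulf_eq0 (negPf ad0) orbF subr_eq0 => /eqP.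
move: rda rNda; rewrite -ad => /eqP.
rewrite mulf_eq0 (negPf (nscalar ad)) /= => /eqP e1.
move=> /eqP; rewrite oppr_eq0 mulf_eq0 (negPf (nscalar ad)) /= => /eqP e2.
(* [e1] and [e2] are r'(a) = 0 and r'(-a) = 0. Their sum is 6 a^2 plus twice the second symmetric
   function, that is 4 a^2 by [ea]. *)
suff : (a + a) * a = 0 by move/eqP; rewrite mulf_eq0 (negPf aa0) (negPf a0).
lra.
Qed.

End TriangularCotangent.

(** * Coordinates on the cotangent algebra of a triangular [lie3] algebra *)

Section Cotangent3.
Context {R : realFieldType} {h : lieAlgType R}.

Lemma triangular_no_complex (a c d : R) (x y z : h)
  (dim_h : \dim {:h} = 3%N) (J : 'End(cotangent h)) :
  lie3_basis a 0 c d x y z -> complex_structure J ->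
  a != 0 -> d != 0 -> a + d != 0 -> (a = d -> c != 0) -> False.
Proof.
move=> [/(free3_basis dim_h) bX xy xz yz] cJ a0 d0 ad0 nsc.
have [E cx cy cz] := free3_coord bX.
set X := [tuple x; y; z] in bX E cx cy cz.
have lin1 i : scalar (fun u : cotangent h => coord X i u.1).
  by move=> k u v; rewrite /= linearP.
have lin2 (w : h) : scalar (fun u : cotangent h => (u.2 : 'Hom(h, R^o)) w : R).
  by move=> k u v; rewrite /= add_lfunE scale_lfunE.
pose f1 i : {scalar cotangent h} := HB.pack
  (fun u : cotangent h => coord X i u.1)
  (GRing.isLinear.Build R (cotangent h) R *%R _ (lin1 i)).
pose f2 w : {scalar cotangent h} := HB.pack
  (fun u : cotangent h => (u.2 : 'Hom(h, R^o)) w : R)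
  (GRing.isLinear.Build R (cotangent h) R *%R _ (lin2 w)).
have dimT : \dim {:cotangent h} = 6%N.
  have dh : dim h = 3%N by rewrite -dimvf.
  by rewrite dimvf -[dim _]/(dim h + dim h * 1)%N dh.
have surj k0 k1 k2 k3 k4 k5 : exists u : cotangent h,
  [/\ f1 0 u = k0, f1 1 u = k1 & f1 2 u = k2] /\
  [/\ f2 y u = k3, f2 z u = k4 & f2 x u = k5].
  have lphi : linear (fun w : h => k5 * coord X 0 w + k3 * coord X 1 w
      + k4 * coord X 2 w : R^o).
    move=> k u v; rewrite !linearP /= /GRing.scale /=; ring.
  pose phi : {linear h -> R^o} := HB.pack
    (fun w : h => k5 * coord X 0 w + k3 * coord X 1 w + k4 * coord X 2 w : R^o)
    (GRing.isLinear.Build R h R^o *:%R _ lphi).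
  exists (k0 *: x + k1 *: y + k2 *: z, linfun phi); split; split.
  1-3: by rewrite /f1 /= !(linearD, linearZ) /= cx cy cz /GRing.scale /=; ring.
  1-3: by apply: (etrans (lfunE phi _)); rewrite /= !(cx, cy, cz) /=; ring.
have lieC i (u v : h) : coord X i (lie u v)
    = (coord X 0 u * coord X 1 v - coord X 1 u * coord X 0 v) * a * (1 == i)%:R
    + (coord X 0 u * coord X 2 v - coord X 2 u * coord X 0 v)
      * (c * (1 == i)%:R + d * (2 == i)%:R).
  rewrite {1}(E u) {1}(E v) !(lieDl, lieZl, linearD, linearZ) /=.
  rewrite !liexx (lie_anti y x) (lie_anti z x) (lie_anti z y) xy xz yz.
  rewrite !(linearD, linearZ, linearN, linear0) /= !cy !cz /GRing.scale /=.
  ring.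
have liex (u : h) : lie u x
    = - (coord X 1 u * a + coord X 2 u * c) *: y - (coord X 2 u * d) *: z.
  rewrite [in LHS](E u) !(lieDl, lieZl) liexx (lie_anti y x) (lie_anti z x).
  rewrite xy xz.
  rewrite [RHS]E; rewrite [LHS]E.
  rewrite !(linearD, linearZ, linearN, linear0) /= ?cx !cy !cz /GRing.scale /=.
  by congr (_ *: _ + _ *: _ + _ *: _); ring.
have liey (u : h) : lie u y = (coord X 0 u * a) *: y.
  rewrite [in LHS](E u) !(lieDl, lieZl) liexx (lie_anti z y) xy yz.
  by rewrite oppr0 !scaler0 scale0r !addr0 scalerA.
have liez (u : h) : lie u z = coord X 0 u *: (c *: y + d *: z).
  by rewrite [in LHS](E u) !(lieDl, lieZl) liexx xz yz !scaler0 !addr0.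
have coE (u v : cotangent h) (w : h) :
    f2 w (lie u v) = - v.2 (lie u.1 w) + u.2 (lie v.1 w).
  by rewrite /f2 /= add_lfunE coadE opp_lfunE coadE opprK.
(* The functional dual to [x]: it plays the central vector z. *)
have [u0 u0E] := surj 0 0 0 0 0 1.
apply: (@triangular_cotangent_no_complex R (cotangent h) a c d
  (f1 0) (f1 1) (f1 2) (f2 y) (f2 z) (f2 x) u0 _ surj u0E _ _ _ _ _ _
  a0 d0 ad0 nsc dimT J cJ).
- move=> u v e0 e1 e2 e3 e4 e5.
  case: u v e0 e1 e2 e3 e4 e5 => [u phi] [v psi] /= e0 e1 e2 e3 e4 e5.
  congr (_, _); first by rewrite (E u) (E v) e0 e1 e2.
  by apply/lfunP => w; rewrite (E w) !linearD !linearZ /= e3 e4 e5.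
- by move=> u v; rewrite /f1 /= lieC /=; ring.
- by move=> u v; rewrite /f1 /= lieC /=; ring.
- by move=> u v; rewrite /f1 /= lieC /=; ring.
- by move=> u v; rewrite coE !liey !linearZ /f1 /f2 /= /GRing.scale /=; ring.
- move=> u v; rewrite coE !liez !linearZ !linearD !linearZ /f1 /f2 /=.
  by rewrite /GRing.scale /=; ring.
- move=> u v; rewrite coE !liex /f1 /f2 /= !linearB !linearZ /= /GRing.scale /=.
  ring.
Qed.

End Cotangent3.

(** * Real and complex spectrum; the classification *)

Lemma lie3_basis_triangular {R : rcfType} {h : lieAlgType R} (a b c d : R)
    (x y z : h) :
  0 <= (a - d) ^+ 2 + 4 * (b * c) -> lie3_basis a b c d x y z ->
  exists a' c' d' x' y' z', lie3_basis a' 0 c' d' x' y' (z' : h).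
Proof.
move=> disc bas; have [b0|b0] := eqVneq b 0.
  by exists a, c, d, x, y, z; rewrite -b0.
(* The radicand is the discriminant of the characteristic polynomial, so [s] yields a real
   eigenvalue. *)
set s := Num.sqrt ((a - d) ^+ 2 + 4 * (b * c)).
have s2 : s ^+ 2 = (a - d) ^+ 2 + 4 * (b * c) by rewrite sqr_sqrtr.
pose k := (a + d + s) / 2.
have ek : (k - a) * (k - d) = b * c.
  rewrite /k; have -> : (a + d + s) / 2 - a = (s - (a - d)) / 2 by field.
  have -> : (a + d + s) / 2 - d = (s + (a - d)) / 2 by field.
  have -> : b * c = (s ^+ 2 - (a - d) ^+ 2) / 4 by rewrite s2; field.
  by field.
(* k is an eigenvalue of the matrix and (k - d, b) an eigenvector. *)
exists k, 1, (a + d - k), (1 *: x), ((k - d) *: y + b *: z), (1 *: y + 0 *: z).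
apply: (lie3_basis_change _ _ _ _ _ _ bas); rewrite ?oner_neq0 //; try ring.
  by rewrite mulr0 mulr1 sub0r oppr_eq0.
transitivity ((k - d) * a + (k - a) * (k - d)); last by ring.
by rewrite ek; ring.
Qed.

Theorem theorem4p9 (R : realType) (h : lieAlgType R)
  (dim_h : \dim {:h} = 3%N)
  (solv_h : lie_solvable h)
  (nonab_h : ~ lie_abelian h)
  (cplx_h : exists J : 'End(cotangent h), complex_structure J) :
  lie_isomorphic h (heis3 R) \/
  lie_isomorphic h (R_aff R) \/
  lie_isomorphic h (r3 (1 : R)) \/
  lie_isomorphic h (r3 (- 1 : R)) \/
  (exists eta : R, 0 <= eta /\ lie_isomorphic h (r3' eta)).
Proof.
have [a [b [c [d [x [y [z bas]]]]]]] := solvable_lie3_basis dim_h solv_h.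
have [disc|disc] := lerP 0 ((a - d) ^+ 2 + 4 * (b * c)); last first.
  do 4 right.
  (* The eigenvalues are (a + d)/2 + i m and its conjugate. *)
  pose m := Num.sqrt (- ((a - d) ^+ 2 + 4 * (b * c))) / 2.
  have m2 : m ^+ 2 = - ((a - d) ^+ 2 + 4 * (b * c)) / 4.
    by rewrite expr_div_n sqr_sqrtr ?oppr_ge0 ?ltW //; field.
  have m0 : 0 < m by rewrite divr_gt0 // sqrtr_gt0 oppr_gt0.
  have b0 : b != 0.
    apply: contraTneq disc => ->; rewrite mul0r mulr0 addr0 -leNgt.
    exact: sqr_ge0.
  (* Scaling by 1/m normalises the imaginary parts to 1 and -1; the sign makes the real part [eta]
     non-negative. *)
  pose s := if 0 <= a + d then m^-1 else - m^-1.
  have s0 : s != 0.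
    by rewrite /s; case: ifP; rewrite ?oppr_eq0 invr_eq0 gt_eqF.
  have s2 : s ^+ 2 * m ^+ 2 = 1.
    have <- : (m^-1) ^+ 2 = s ^+ 2 by rewrite /s; case: ifP; rewrite ?sqrrN.
    by rewrite -exprMn mulVf ?expr1n // gt_eqF.
  pose eta := s * (a + d) / 2; exists eta; split.
    rewrite /eta /s divr_ge0 //; case: ifP => [ad|/negbT].
      by rewrite mulr_ge0 // invr_ge0 ltW.
    rewrite -ltNge => ad; rewrite mulNr -mulrN mulr_ge0 ?invr_ge0 ?ltW //.
    by rewrite oppr_gt0.
  (* The third vector is forced by [e_1, e_2] = eta e_2 - e_3 with e_1 = s x and e_2 = y. *)
  apply: (lie3_iso dim_h (x := s *: x) (y := 1 *: y + 0 *: z)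
    (z := (eta - s * a) *: y + (- s * b) *: z)).
  apply: (lie3_basis_change _ _ _ _ _ _ bas) => //.
  - by rewrite mul1r mul0r subr0 mulf_neq0 // oppr_eq0.
  - by ring.
  - by ring.
  - by rewrite mul1r -s2 m2 /eta; field.
  - by rewrite /eta; field.
have {bas disc a b c d x y z} [a [c [d [x [y [z bas]]]]]] :=
  lie3_basis_triangular disc bas.
have iso := lie3_iso dim_h (lie3_basis_change _ _ _ _ _ _ bas).
(* Split on the eigenvalues a and d. When they are distinct, the new basis of the plane consists of
   eigenvectors; when both vanish, A is nilpotent and non-zero. *)
have [a0|a0] := eqVneq a 0; have [d0|d0] := eqVneq d 0.
- have c0 : c != 0.
    apply/eqP => c0; exact: (lie3_basis_neq0 dim_h nonab_h bas).
  left; apply: (iso _ _ _ _ 1 0 1 c 0); rewrite ?a0 ?d0 ?oner_neq0 //; try ring.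
  by rewrite mul0r mul1r sub0r oppr_eq0.
- right; left; apply: (iso _ _ _ _ d^-1 c d 1 0); rewrite ?a0 ?invr_eq0 //;
    try by field.
  by rewrite mulr0 mulr1 sub0r oppr_eq0.
- right; left; apply: (iso _ _ _ _ a^-1 1 0 c (- a)); rewrite ?d0 ?invr_eq0 //;
    try by field.
  by rewrite mul1r mul0r subr0 oppr_eq0.
have [ad0|ad0] := eqVneq (a + d) 0.
  have dE : d = - a by apply/eqP; rewrite -addr_eq0 addrC ad0.
  do 3 right; left; apply: (iso _ _ _ _ a^-1 1 0 c (d - a));
    rewrite ?dE ?invr_eq0 //; try by field.
  by rewrite mul1r mul0r subr0 -opprD oppr_eq0 -mulr2n mulrn_eq0.
have [J cJ] := cplx_h.
(* Now a, d and a + d are non-zero, so the complex structure forces A to be scalar, which is the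
   case of r_{3,1}. *)
have [ad|ad] := eqVneq a d; last first.
  have [] := triangular_no_complex dim_h bas cJ a0 d0 ad0.
  by move/eqP; rewrite (negPf ad).
have [c0|c0] := eqVneq c 0; last first.
  by have [] := triangular_no_complex dim_h bas cJ a0 d0 ad0.
do 2 right; left; apply: (iso _ _ _ _ a^-1 1 0 0 1);
  rewrite -?ad ?c0 ?invr_eq0 //; try by field.
by rewrite mul1r mul0r subr0 oner_neq0.
Qed.
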